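(* The algorithm BH described in the context determines an optimal deviation vector, if one exists, for the constrained minimum-cost inverse optimization problem $(S,\mathcal{F},F^*,c,\ell,u,\mathrm{H}_{\infty,w}(\cdot))$ under the weighted bottleneck Hamming distance objective (and otherwise outputs ''Infeasible''), using $O(n)$ calls to the oracle $\mathcal{O}$, where $n=|S|$.
   Context: An instance consists of: a finite ground set $S$ with $n=|S|$; a collection $\mathcal{F}\subseteq 2^S$ of feasible solutions of an underlying optimization problem; an input solution $F^*\in\mathcal{F}$; a cost function $c\in\mathbb{R}^S$; a positive weight function $w\in\mathbb{R}_+^S$; and bounds $\ell\colon S\to\mathbb{R}\cup\{-\infty\}$, $u\colon S\to\mathbb{R}\cup\{+\infty\}$ with $\ell\le u$. For $x\in\mathbb{R}^S$ and $X\subseteq S$, $x(X)=\sum_{s\in X}x(s)$. Conventions: $\min\emptyset=+\infty$, $\max\emptyset=-\infty$. The oracle $\mathcal{O}$ returns, for any $c'\in\mathbb{R}^S$, a member of $\mathcal{F}$ of minimum $c'$-cost. A deviation vector $p\in\mathbb{R}^S$ is feasible if (a) $F^*$ is a minimum-cost member of $\mathcal{F}$ with respect to $c-p$, and (b) $\ell\le p\le u$. It is optimal if it is feasible and minimizes, among feasible deviation vectors, $\mathrm{H}_{\infty,w}(p)=\max\{w(s)\mid s\in S,\ p(s)\ne 0\}$. Define $$m=\max\Big\{0,\ \max_{F\in\mathcal{F}}\Big(c(F^* )-c(F)-\sum_{s\in F^*\setminus F,\ u(s)<0}u(s)+\sum_{s\in F\setminus F^*,\ \ell(s)>0}\ell(s)\Big)\Big\}.$$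 For $\delta\ge 0$ define $p_\delta\colon S\to\mathbb{R}$ by: - $p_\delta(s)=u(s)$ if $s\in F^*$, $u(s)\ne+\infty$ and $w(s)\le\delta$; - $p_\delta(s)=m$ if $s\in F^*$, $u(s)=+\infty$ and $w(s)\le\delta$; - $p_\delta(s)=\ell(s)$ if $s\in S\setminus F^*$, $\ell(s)\ne-\infty$ and $w(s)\le\delta$; - $p_\delta(s)=-m$ if $s\in S\setminus F^*$, $\ell(s)=-\infty$ and $w(s)\le\delta$; - $p_\delta(s)=0$ otherwise. Algorithm BH: 1. Set $\delta_0=\max\{0,\ \max\{w(s)\mid s\in S,\ \ell(s)>0\},\ \max\{w(s)\mid s\in S,\ u(s)<0\}\}$ and $c_0=c-p_{\delta_0}$. Let $F_0$ be a minimum $c_0$-cost member of $\mathcal{F}$ determined by $\mathcal{O}$. Set $i=0$. 2. While $c_i(F^* )>c_i(F_i)$, do the following. Let $S_i=\{s\in S\mid w(s)>\delta_i\}$. If $S_i=\emptyset$, return ''Infeasible'' and stop. Otherwise set $\delta_{i+1}=\min\{w(s)\mid s\in S_i\}$ and $c_{i+1}=c-p_{\delta_{i+1}}$, let $F_{i+1}$ be a minimum $c_{i+1}$-cost member of $\mathcal{F}$ determined by $\mathcal{O}$, and increase $i$ by $1$. 3. Return $p_{\delta_i}$.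
   Formalization: Optimality of the returned vector is claimed only if ℓ(s) ≤ m for all s in F* with u(s)=+∞ and −m ≤ u(s) for all s outside F* with ℓ(s)=−∞; otherwise the returned p_δ violates a bound, so the literal claim is false. *)

(* Defs.v *)
(* MathComp world; the reals are an arbitrary [R : realType]. *)
From HB Require Import structures.
From mathcomp Require Import all_boot all_order all_algebra.
From mathcomp Require Import constructive_ereal reals.

Set Implicit Arguments.
Unset Strict Implicit.
Unset Printing Implicit Defensive.

Import Order.TTheory GRing.Theory Num.Theory.
Local Open Scope ring_scope.

Record instance (R : realType) (S : finType) := Instance {
  feas : {set {set S}};
  Fstar : {set S};
  cost : S -> R;
  weight : S -> R;
  lower : S -> \bar R;
  upper : S -> \bar R;
  Fstar_feas : Fstar \in feas;
  weight_gt0 : forall s, 0 < weight s;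
  lower_neq_pinfty : forall s, lower s != +oo%E;
  upper_neq_ninfty : forall s, upper s != -oo%E;
  lower_le_upper : forall s, (lower s <= upper s)%E
}.

Section InverseProblem.
Variables (R : realType) (S : finType) (I : instance R S).

Definition total (x : S -> R) (X : {set S}) : R := \sum_(s in X) x s.

Definition min_cost_member (c : S -> R) (F : {set S}) : Prop :=
  F \in feas I /\ forall F', F' \in feas I -> total c F <= total c F'.

Definition feasible_dev (p : S -> R) : Prop :=
  min_cost_member (cost I \- p) (Fstar I) /\
  forall s, (lower I s <= (p s)%:E <= upper I s)%E.

(* The value is [-oo] when [p] is identically zero. *)
Definition H_infty (p : S -> R) : \bar R :=
  \big[Order.max/-oo%E]_(s | p s != 0) (weight I s)%:E.

Definition optimal_dev (p : S -> R) : Prop :=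
  feasible_dev p /\
  forall q, feasible_dev q -> (H_infty p <= H_infty q)%E.

(* Taking [0] as the base value of [\big[Num.max/0]] accounts for the outer
   [max {0, _}].  Every [fine] is applied to a finite value: a lower bound is
   never [+oo] and an upper bound is never [-oo]. *)
Definition m_bound : R :=
  \big[Num.max/0]_(F in feas I)
    (total (cost I) (Fstar I) - total (cost I) F
     - \sum_(s in Fstar I :\: F | (upper I s < 0)%E) fine (upper I s)
     + \sum_(s in F :\: Fstar I | (0 < lower I s)%E) fine (lower I s)).

Definition p_dev (delta : R) (s : S) : R :=
  if weight I s <= delta then
    if s \in Fstar I then
      if upper I s == +oo%E then m_bound else fine (upper I s)
    else
      if lower I s == -oo%E then - m_bound else fine (lower I s)
  else 0.

Definition delta_init : R :=
  Num.max (\big[Num.max/0]_(s | (0 < lower I s)%E) weight I s)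
          (\big[Num.max/0]_(s | (upper I s < 0)%E) weight I s).

Definition heavier (delta : R) : {set S} := [set s | delta < weight I s].

(* Only used when [heavier delta] is nonempty, where the minimum is finite. *)
Definition delta_next (delta : R) : R :=
  fine (\big[Order.min/+oo%E]_(s in heavier delta) (weight I s)%:E).

Definition is_oracle (O : (S -> R) -> {set S}) : Prop :=
  forall c, min_cost_member c (O c).

Definition cost_dev (delta : R) : S -> R := cost I \- p_dev delta.

(* [BH_loop O delta F k out]: entering the while loop with current values
   [delta_i = delta] and [F_i = F], the execution stops with output [out] after
   [k] further oracle calls.  The output ["Infeasible"] is [None]. *)
Inductive BH_loop (O : (S -> R) -> {set S}) :
    R -> {set S} -> nat -> option (S -> R) -> Prop :=
| BH_return delta F :
    ~~ (total (cost_dev delta) F < total (cost_dev delta) (Fstar I)) ->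
    BH_loop O delta F 0 (Some (p_dev delta))
| BH_infeasible delta F :
    total (cost_dev delta) F < total (cost_dev delta) (Fstar I) ->
    heavier delta = set0 ->
    BH_loop O delta F 0 None
| BH_step delta F k out :
    total (cost_dev delta) F < total (cost_dev delta) (Fstar I) ->
    heavier delta != set0 ->
    BH_loop O (delta_next delta) (O (cost_dev (delta_next delta))) k out ->
    BH_loop O delta F k.+1 out.

Inductive BH_run (O : (S -> R) -> {set S}) : nat -> option (S -> R) -> Prop :=
| BH_start k out :
    BH_loop O delta_init (O (cost_dev delta_init)) k out ->
    BH_run O k.+1 out.

(* Where a bound on the far side is infinite, [p_dev] uses [m] or [- m] in its
   place.  That value can violate the other, finite bound: with
   [feas = {Fstar}] one has [m = 0], so an element of [Fstar] with bounds
   [[1, +oo[] receives the value [0].  This condition excludes exactly that. *)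
Definition m_within_bounds : Prop :=
  (forall s, s \in Fstar I -> upper I s = +oo%E ->
     (lower I s <= m_bound%:E)%E) /\
  (forall s, s \notin Fstar I -> lower I s = -oo%E ->
     ((- m_bound)%:E <= upper I s)%E).

End InverseProblem.

(* Main.v *)
Require Import Defs.
From mathcomp Require Import all_boot all_order all_algebra.
From mathcomp Require Import constructive_ereal reals.
From mathcomp Require Import lra.

Set Implicit Arguments.
Unset Strict Implicit.
Unset Printing Implicit Defensive.

Import Order.TTheory GRing.Theory Num.Theory.
(* Gives [total] back its meaning as the cost of a set, instead of the totality
   of a relation. *)
Import Defs.
Local Open Scope ring_scope.

(** The algorithm rests on one monotonicity fact and two claims derived from it.

    Passing from [c] to [c \- p] changes the cost of [Fstar] relative to [F]
    through [gain p F] only, the value of [p] on [Fstar :\: F] minus its value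
    on [F :\: Fstar]: condition (a) says that [gain c F <= gain p F] for every
    feasible [F].  Hence raising [p] on [Fstar] and lowering it elsewhere
    preserves (a).  Say that [p] is supported below [delta] if it vanishes at
    the elements of weight larger than [delta].

    _Sufficiency._  Let [delta >= delta_init], so that elements heavier than
    [delta] allow the deviation [0].  If some feasible [q] is supported below
    [delta], then [p_dev delta] satisfies (a) ([feasible_light_min]).  Indeed
    [p_dev delta] takes the extreme value that each bound permits, so its gain
    at [F] dominates that of [q], except where an infinite bound has been
    replaced by [m] or [- m]; and a single such element of the symmetric
    difference suffices, because [m] is at least the gain required at [F] plus all
    the losses that the bounds force elsewhere.

    _Repair._  If [p_dev delta] satisfies (a), some feasible vector is supported
    below [delta]: [p_dev delta] can only violate a bound on the near side
    (the lower one on [Fstar], the upper one elsewhere), and moving onto that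
    bound goes in the direction that preserves (a) ([clip_feasible]).

    A third property holds along the run: no feasible deviation vector has an
    objective below a weight that is at most the current [delta]
    ([H_lower_bound]).  It holds initially since the elements that define
    [delta_init] cannot receive the deviation [0].  It persists because, when
    the test fails at [delta], sufficiency shows that every feasible vector is
    nonzero at some element heavier than [delta], hence of weight at least
    [delta_next delta].  Any feasible vector supported below the final [delta]
    is therefore optimal: [p_dev delta] itself if [m] respects the bounds, its
    repair in general.  If instead no element is heavier than [delta], every
    vector is supported below [delta], and a failed test rules out feasible
    vectors altogether.

    Each iteration strictly shrinks [heavier delta], so there are at most
    [1 + #|S|] oracle calls, and [1 + #|S| <= 2 * #|S|] if [S] is nonempty. *)

(** * Deviations as gains of the input solution *)

(** Isolates the one term that carries the surplus [d]; with [x] the guaranteed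
    values and [y] those of [p_dev], [s0] is an element with an infinite bound
    and [d] is [m]. *)
Lemma ler_sum_gap (R : realDomainType) (S : finType) (A : {set S})
    (x y : S -> R) (d : R) (s0 : S) :
  (forall s, s \in A -> x s <= y s) -> s0 \in A -> x s0 + d <= y s0 ->
  \sum_(s in A) x s + d <= \sum_(s in A) y s.
Proof.
move=> lexy As0 gap; rewrite (bigD1 s0) //= [leRHS](bigD1 s0) //=.
have := ler_sum (index_enum S) (fun s (sP : (s \in A) && (s != s0)) =>
  lexy s (proj1 (andP sP))).
by move: (\sum_(_ <- _ | _) _) (\sum_(_ <- _ | _) _) => a b; lra.
Qed.

Section Deviations.
Variables (R : realType) (S : finType) (I : instance R S).
Implicit Types (p q : S -> R) (F : {set S}) (delta : R) (s t : S).

(** What [Fstar] gains over [F] when the costs are lowered by [p]: the elements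
    of the intersection cancel. *)
Definition gain p F := total p (Fstar I :\: F) - total p (F :\: Fstar I).

Lemma total_diff (x : S -> R) F :
  total x (Fstar I) - total x F = gain x F.
Proof.
rewrite /gain /total (big_setID F) /= [X in _ - X](big_setID (Fstar I)) /=.
rewrite [F :&: _]setIC.
by move: (\sum_(_ in _) _) (\sum_(_ in _) _) (\sum_(_ in _) _) => a b c; lra.
Qed.

Lemma totalB (x y : S -> R) F : total (x \- y) F = total x F - total y F.
Proof. exact: sumrB. Qed.

(** By linearity and [total_diff], the inequality between the [c - p] costs of
    [Fstar] and [F] becomes a lower bound on the gain of [p]. *)
Lemma min_cost_gainP p :
  min_cost_member I (cost I \- p) (Fstar I) <->
  forall F, F \in feas I -> gain (cost I) F <= gain p F.
Proof.
split=> [[_ minF] F /minF|leF].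
  by rewrite !totalB -!total_diff; lra.
split=> [|F /leF]; first exact: Fstar_feas.
by rewrite !totalB -!total_diff; lra.
Qed.

Lemma le_gain p q F :
  (forall s, s \in Fstar I :\: F -> p s <= q s) ->
  (forall s, s \in F :\: Fstar I -> q s <= p s) -> gain p F <= gain q F.
Proof. by move=> lepq leqp; rewrite lerB // ler_sum. Qed.

Lemma m_bound_ge0 : 0 <= m_bound I.
Proof. exact: bigmax_ge_id. Qed.

(** The defining property of [m], in the form in which the finite bounds that
    exclude [0] enter as a pointwise lower estimate of a deviation on
    [Fstar :\: F] and an upper one on [F :\: Fstar]. *)
Lemma gain_cost_le_m F : F \in feas I ->
  gain (cost I) F <=
    m_bound I
    + \sum_(s in Fstar I :\: F) (if (upper I s < 0)%E then fine (upper I s) else 0)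
    - \sum_(s in F :\: Fstar I) (if (0 < lower I s)%E then fine (lower I s) else 0).
Proof.
move=> Ffeas; rewrite -total_diff -!big_mkcondr /=.
have := le_bigmax_cond 0 (fun F => total (cost I) (Fstar I) - total (cost I) F
     - \sum_(s in Fstar I :\: F | (upper I s < 0)%E) fine (upper I s)
     + \sum_(s in F :\: Fstar I | (0 < lower I s)%E) fine (lower I s)) Ffeas.
rewrite -/(m_bound I) /=.
by move: (m_bound I) (\sum_(_ <- _ | _) _) (\sum_(_ <- _ | _) _) => m a b; lra.
Qed.

Lemma fine_lower_le s p : lower I s != -oo%E -> (lower I s <= (p s)%:E)%E ->
  fine (lower I s) <= p s.
Proof. by have := lower_neq_pinfty I s; case: (lower I s). Qed.

Lemma fine_upper_ge s p : upper I s != +oo%E -> ((p s)%:E <= upper I s)%E ->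
  p s <= fine (upper I s).
Proof. by have := upper_neq_ninfty I s; case: (upper I s). Qed.

(** * The vectors tried by the algorithm *)

Section Threshold.
Variables (delta : R).
Hypothesis (delta_ge : delta_init I <= delta).

Lemma heavy_bounds s : delta < weight I s ->
  (lower I s <= 0)%E /\ (0 <= upper I s)%E.
Proof.
move: delta_ge; rewrite /delta_init ge_max.
case/andP=> /bigmax_leP[_ dl] /bigmax_leP[_ du]; rewrite ltNge => heavy.
by split; rewrite leNgt; apply: contra heavy => ?; [exact: dl|exact: du].
Qed.

(** The next two lemmas concern the far bound only, the one that [p_dev] is set
    to; the near bound may fail when the far one is infinite. *)
Lemma p_dev_le_upper s : s \in Fstar I -> ((p_dev I delta s)%:E <= upper I s)%E.
Proof.
rewrite /p_dev => ->; case: (leP (weight I s) delta) => [_|/heavy_bounds[]//].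
have := upper_neq_ninfty I s.
by case: (upper I s) => [r||]//= _; rewrite leey.
Qed.

Lemma p_dev_ge_lower s :
  s \notin Fstar I -> (lower I s <= (p_dev I delta s)%:E)%E.
Proof.
rewrite /p_dev => /negPf ->; case: (leP (weight I s) delta) => [_|/heavy_bounds[]//].
have := lower_neq_pinfty I s.
by case: (lower I s) => [r||]//= _; rewrite leNye.
Qed.

(** On [Fstar], the only negative values are negative upper bounds: [m] is
    nonnegative, and elements heavier than [delta] have a nonnegative upper
    bound. *)
Lemma p_dev_in_ge s : s \in Fstar I ->
  (if (upper I s < 0)%E then fine (upper I s) else 0) <= p_dev I delta s.
Proof.
rewrite /p_dev => ->;
case: (leP (weight I s) delta) => [_|/heavy_bounds[_]]; last first.
  by rewrite leNgt; case: ifP.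
have := m_bound_ge0; have := upper_neq_ninfty I s.
case: (upper I s) => [r||]//= _ m_ge0.
by rewrite lte_fin; case: ltP.
Qed.

Lemma p_dev_out_le s : s \notin Fstar I ->
  p_dev I delta s <= (if (0 < lower I s)%E then fine (lower I s) else 0).
Proof.
rewrite /p_dev => /negPf ->;
case: (leP (weight I s) delta) => [_|/heavy_bounds[+ _]]; last first.
  by rewrite leNgt; case: ifP.
have := m_bound_ge0; have := lower_neq_pinfty I s.
case: (lower I s) => [r||]//= _ m_ge0; last by rewrite oppr_le0.
by rewrite lte_fin; case: ltP.
Qed.

(** Against a fixed [F], either the symmetric difference contains an element
    where [p_dev] uses [m] or [- m], and that element alone yields the required
    gain, or [p_dev] is as favourable as [q] at every element. *)
Lemma feasible_light_min q :
  feasible_dev I q -> (forall s, delta < weight I s -> q s = 0) ->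
  min_cost_member I (cost_dev I delta) (Fstar I).
Proof.
move=> [/min_cost_gainP minq qb] q0; apply/min_cost_gainP => F Ffeas.
pose A := [set s in Fstar I :\: F | (upper I s == +oo%E) && (weight I s <= delta)].
pose B := [set s in F :\: Fstar I | (lower I s == -oo%E) && (weight I s <= delta)].
have inA s : s \in Fstar I :\: F -> s \in Fstar I by case/setDP.
have outB s : s \in F :\: Fstar I -> s \notin Fstar I by case/setDP.
have leA s (sD : s \in Fstar I :\: F) := p_dev_in_ge (inA s sD).
have leB s (sD : s \in F :\: Fstar I) := p_dev_out_le (outB s sD).
have sumA := ler_sum (index_enum S) leA.
have sumB := ler_sum (index_enum S) leB.
have gcm := gain_cost_le_m Ffeas.
(* An element of [A], or below of [B], contributes [m] on top of the
   pointwise estimate. *)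
have [A0|[s]] := set_0Vmem A; last first.
  rewrite inE => /andP[sA /andP[/eqP us ws]].
  have := ler_sum_gap leA sA (d := m_bound I).
  rewrite /p_dev ws (inA _ sA) us eqxx /= add0r => /(_ (lexx _)).
  move: gcm sumB; rewrite /gain /total /p_dev.
  by do ![move: (\sum_(_ in _) _) => ?]; lra.
have [B0|[s]] := set_0Vmem B; last first.
  rewrite inE => /andP[sB /andP[/eqP ls ws]].
  have := ler_sum_gap leB sB (d := m_bound I).
  rewrite /p_dev ws (negPf (outB _ sB)) ls eqxx /= addNr => /(_ (lexx _)).
  move: gcm sumA; rewrite /gain /total /p_dev.
  by do ![move: (\sum_(_ in _) _) => ?]; lra.
(* No infinite bound intervenes: light elements sit at their extreme finite
   bound, and at heavy ones both [p_dev] and [q] vanish. *)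
apply: le_trans (minq F Ffeas) _; apply: le_gain => s sD.
  rewrite /p_dev (inA _ sD); case: (leP (weight I s) delta) => [ws|/q0->//].
  have: s \notin A by rewrite A0 inE.
  rewrite inE sD ws andbT /= => unoo; rewrite (negPf unoo).
  by apply: fine_upper_ge => //; case/andP: (qb s).
rewrite /p_dev (negPf (outB _ sD)); case: (leP (weight I s) delta) => [ws|/q0->//].
have: s \notin B by rewrite B0 inE.
rewrite inE sD ws andbT /= => lnoo; rewrite (negPf lnoo).
by apply: fine_lower_le => //; case/andP: (qb s).
Qed.

Lemma m_within_feasible : m_within_bounds I ->
  min_cost_member I (cost_dev I delta) (Fstar I) ->
  feasible_dev I (p_dev I delta).
Proof.
move=> [mu ml] minp; split=> // s.
have [sF|sF] := boolP (s \in Fstar I).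
  rewrite p_dev_le_upper // andbT /p_dev sF.
  case: (leP (weight I s) delta) => [_|/heavy_bounds[]//].
  case: eqP => [/mu->//|/eqP unoo].
  rewrite fineK ?lower_le_upper // fin_numE unoo.
  by rewrite upper_neq_ninfty.
rewrite p_dev_ge_lower //= /p_dev (negPf sF).
case: (leP (weight I s) delta) => [_|/heavy_bounds[]//].
case: eqP => [/ml->//|/eqP lnoo].
rewrite fineK ?lower_le_upper // fin_numE lnoo.
by rewrite lower_neq_pinfty.
Qed.

(** [p_dev delta] moved onto its near bound where it violates it.  The value
    inside [fine] is always finite, the near bound not being infinite in the
    wrong direction. *)
Definition clip s : R :=
  fine (if s \in Fstar I then Order.max (p_dev I delta s)%:E (lower I s)
        else Order.min (p_dev I delta s)%:E (upper I s)).

Lemma clip_in s : s \in Fstar I ->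
  (clip s)%:E = Order.max (p_dev I delta s)%:E (lower I s).
Proof.
rewrite /clip => ->; rewrite fineK // fin_numE.
have := lower_neq_pinfty I s; case: (lower I s) => [r||]//= _.
by rewrite -EFin_max.
Qed.

Lemma clip_out s : s \notin Fstar I ->
  (clip s)%:E = Order.min (p_dev I delta s)%:E (upper I s).
Proof.
rewrite /clip => /negPf ->; rewrite fineK // fin_numE.
have := upper_neq_ninfty I s; case: (upper I s) => [r||]//= _.
  by rewrite -EFin_min.
by rewrite miney.
Qed.

Lemma clip_heavy s : delta < weight I s -> clip s = 0.
Proof.
move=> heavy; have [l0 u0] := heavy_bounds heavy.
have p0 : p_dev I delta s = 0 by rewrite /p_dev leNgt heavy.
apply: EFin_inj; have [/clip_in->|/clip_out->] := boolP (s \in Fstar I).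
  by rewrite p0 max_l.
by rewrite p0 min_l.
Qed.

(** Clipping raises the deviation on [Fstar] and lowers it elsewhere, so no gain
    decreases; the far bounds survive because [lower <= upper]. *)
Lemma clip_feasible : min_cost_member I (cost_dev I delta) (Fstar I) ->
  feasible_dev I clip.
Proof.
move=> /min_cost_gainP minp; split.
  apply/min_cost_gainP => F /minp/le_trans; apply; apply: le_gain => s /setDP[].
    by move=> sF _; rewrite -lee_fin clip_in // le_max lexx.
  by move=> _ sF; rewrite -lee_fin clip_out // ge_min lexx.
move=> s; have [sF|sF] := boolP (s \in Fstar I).
  by rewrite clip_in // le_max lexx orbT /= ge_max p_dev_le_upper ?lower_le_upper.
by rewrite clip_out // ge_min lexx orbT andbT le_min p_dev_ge_lower ?lower_le_upper.
Qed.

End Threshold.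

(** * Lower bounds on the optimum *)

Lemma weight_le_H q s : q s != 0 -> ((weight I s)%:E <= H_infty I q)%E.
Proof. exact: (le_bigmax_cond _ (fun s => (weight I s)%:E)). Qed.

(** Bounding by the weights below [delta], rather than by [delta] itself, also
    covers the initial value [delta = 0]: it is not a weight, and there the
    objective of the zero vector is [-oo]. *)
Definition H_lower_bound delta := forall q, feasible_dev I q ->
  forall s, weight I s <= delta -> ((weight I s)%:E <= H_infty I q)%E.

Lemma H_lower_bound_optimal delta p : H_lower_bound delta ->
  feasible_dev I p -> (forall s, delta < weight I s -> p s = 0) ->
  optimal_dev I p.
Proof.
move=> lb fp p0; split=> // q fq; apply/bigmax_leP; split; first exact: leNye.
move=> s ps; apply: lb => //; rewrite leNgt; apply: contra ps => heavy.
by rewrite p0.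
Qed.

(** A feasible vector is nonzero wherever a bound excludes [0].  If its
    objective were below [weight I s], all those elements would be lighter than
    [s], and so would be [delta_init]. *)
Lemma H_lower_bound_init : H_lower_bound (delta_init I).
Proof.
move=> q [_ qb] s; apply: contraTT; rewrite -!ltNge => Hlt.
have light t : q t != 0 -> weight I t < weight I s.
  by move=> /weight_le_H Ht; rewrite -lte_fin (le_lt_trans Ht).
rewrite /delta_init gt_max; apply/andP; split; apply: bigmax_lt => [|t bt];
  try exact: weight_gt0; apply: light; have /andP[lq uq] := qb t.
  by rewrite gt_eqF // -lte_fin (lt_le_trans bt).
by rewrite lt_eqF // -lte_fin (le_lt_trans uq).
Qed.

Lemma delta_nextP delta : heavier I delta != set0 ->
  exists2 s, delta < weight I s & delta_next I delta = weight I s /\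
    forall t, delta < weight I t -> weight I s <= weight I t.
Proof.
case/set0Pn=> s0 s0h; rewrite /delta_next.
have minle t : delta < weight I t ->
    (\big[Order.min/+oo%E]_(s in heavier I delta) (weight I s)%:E
      <= (weight I t)%:E)%E.
  by move=> ht; apply: bigmin_le_cond; rewrite inE.
have [s + minE] := eq_bigmin s0 _ (fun s => (weight I s)%:E) s0h
  (fun s _ => leey (weight I s)%:E).
by rewrite inE minE /= in minle * => sh; exists s.
Qed.

Lemma heavier_next delta : heavier I delta != set0 ->
  (#|heavier I (delta_next I delta)| < #|heavier I delta|)%N.
Proof.
move=> /delta_nextP[s sh [-> _]]; apply/proper_card/properP; split.
  by apply/subsetP => t; rewrite !inE; exact: lt_trans.
by exists s; rewrite inE ?ltxx.
Qed.

(** A feasible vector of objective below [delta_next delta] would be supported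
    below [delta], no weight lying strictly between the two thresholds; by
    [feasible_light_min] the test at [delta] would then have succeeded. *)
Lemma H_lower_bound_next delta : delta_init I <= delta ->
  ~ min_cost_member I (cost_dev I delta) (Fstar I) ->
  heavier I delta != set0 -> H_lower_bound (delta_next I delta).
Proof.
move=> d0 nmin /delta_nextP[u _ [-> dmin]] q fq s ws.
rewrite leNgt; apply/negP => Hlt.
apply: nmin; apply: (feasible_light_min d0 fq) => t /dmin wt.
apply/eqP; apply: contraTT Hlt => /weight_le_H qt.
by rewrite -leNgt (le_trans _ qt) // lee_fin (le_trans ws).
Qed.

End Deviations.

(** * Correctness and termination of the loop *)

Section Run.
Variables (R : realType) (S : finType) (I : instance R S).
Variable O : (S -> R) -> {set S}.
Hypothesis O_oracle : is_oracle I O.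

Lemma oracle_test_fails (c : S -> R) :
  total c (O c) < total c (Fstar I) -> ~ min_cost_member I c (Fstar I).
Proof.
move=> lt [_ /(_ (O c))]; have [Ofeas _] := O_oracle c.
by move/(_ Ofeas); rewrite leNgt lt.
Qed.

Lemma BH_loop_exists delta F : exists k out, BH_loop I O delta F k out.
Proof.
have [n] := ubnP #|heavier I delta|; elim: n => // n IH in delta F *.
rewrite ltnS => hn.
have [lt|nlt] := boolP (total (cost_dev I delta) F
                        < total (cost_dev I delta) (Fstar I)); last first.
  by exists 0%N, (Some (p_dev I delta)); exact: BH_return.
have [h0|hn0] := eqVneq (heavier I delta) set0.
  by exists 0%N, None; exact: BH_infeasible.
have [|k [out run]] := IH (delta_next I delta) (O (cost_dev I (delta_next I delta))).
  exact: leq_trans (heavier_next hn0) hn.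
by exists k.+1, out; exact: BH_step.
Qed.

(** The equation on [F] records that the loop is always entered with the
    oracle's answer at the current threshold. *)
Lemma BH_loop_correct delta F k out : BH_loop I O delta F k out ->
  F = O (cost_dev I delta) -> delta_init I <= delta -> H_lower_bound I delta ->
  (k <= #|heavier I delta|)%N /\
  if out is Some p then
    exists2 d, p = p_dev I d &
      [/\ delta_init I <= d, H_lower_bound I d
        & min_cost_member I (cost_dev I d) (Fstar I)]
  else forall q, ~ feasible_dev I q.
Proof.
elim=> {delta F k out} [delta F nlt|delta F lt h0|delta F k out lt hn0 _ IH] EF d0 lb.
- split=> //; exists delta => //; split=> //.
  split=> [|F' F'feas]; first exact: Fstar_feas.
  move: nlt; rewrite EF -leNgt => /le_trans; apply.
  by case: (O_oracle (cost_dev I delta)) => _; apply.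
- split=> // q fq; move: lt; rewrite EF => /oracle_test_fails; apply.
  apply: (feasible_light_min d0 fq) => s hs.
  by have := in_set0 s; rewrite -h0 inE hs.
move: lt; rewrite EF => /oracle_test_fails nmin.
have dlt : delta < delta_next I delta by case: (delta_nextP hn0) => u ? [->].
have [] := IH erefl (le_trans d0 (ltW dlt)) (H_lower_bound_next d0 nmin hn0).
by move=> kle; split=> //; exact: leq_ltn_trans kle (heavier_next hn0).
Qed.

End Run.

Theorem theorem4 :
  exists C : nat,
  forall (R : realType) (S : finType) (I : instance R S)
         (O : (S -> R) -> {set S}),
  is_oracle I O ->
  (exists k out, BH_run I O k out) /\
  (forall k out, BH_run I O k out ->
     ((exists p, optimal_dev I p) ->
        exists p, out = Some p /\ (m_within_bounds I -> optimal_dev I p)) /\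
     (~ (exists p, optimal_dev I p) -> out = None) /\
     ((0 < #|S|)%N -> (k <= C * #|S|)%N)).
Proof.
exists 2%N => R S I O O_oracle; split.
  have [k [out run]] :=
    BH_loop_exists I O (delta_init I) (O (cost_dev I (delta_init I))).
  by exists k.+1, out; exact: BH_start.
move=> _ _ [k out run].
have [kle res] :=
  BH_loop_correct O_oracle run erefl (lexx _) (@H_lower_bound_init _ _ I).
split; [|split].
- move=> [q [fq _]]; case: out res {run} => [p [d -> [d0 lb minp]]|/(_ q)//].
  exists (p_dev I d); split=> // mb; apply: (H_lower_bound_optimal lb).
    exact: m_within_feasible.
  by move=> s ws; rewrite /p_dev leNgt ws.
- case: out res {run} => [p [d _ [d0 lb minp]] []|//].
  exists (clip I d); apply: (H_lower_bound_optimal lb); first exact: clip_feasible.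
  by move=> s; exact: clip_heavy.
- move=> S_gt0; rewrite mul2n -addnn -addn1 addnC leq_add //.
  exact: leq_trans kle (max_card _).
Qed.
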